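(* Let $n,k$ be integers with $k\ge 50$ and $n\ge 4k^3$, and let $\mathcal F\subset\binom{[n]}{k}$ with $|\mathcal F|>\binom{n-1}{k-1}$. Then $d(\mathcal F)>0.49|\mathcal F|$.
   Context: $\binom{[n]}{k}$ is the family of $k$-subsets of $[n]$. For $\mathcal F\subset\binom{[n]}{k}$, $d(\mathcal F)=\max_{F\in\mathcal F}|\{G\in\mathcal F:G\cap F=\emptyset\}|$ (the maximum degree of the induced subgraph of the Kneser graph $KG(n,k)$ on $\mathcal F$). *)

(* Defs.v *)
From mathcomp Require Import all_boot all_order all_algebra.

Set Implicit Arguments.
Unset Strict Implicit.
Unset Printing Implicit Defensive.

(* The ground set [n] = {1, ..., n} is represented by 'I_n = {0, ..., n - 1}. *)
Definition ksubsets (n k : nat) : {set {set 'I_n}} :=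
  [set A : {set 'I_n} | #|A| == k].

(* The maximum over an empty family is 0. *)
Definition max_disjoint (n : nat) (F : {set {set 'I_n}}) : nat :=
  \max_(A in F) #|[set B in F | [disjoint B & A]]|.

(* Main.v *)
(** Let [m = #|F|], and write [d x] for the number of members of [F] containing
    [x]. Codegrees are at most ['C(n-2, k-2) <= m / (4k^2)]. If the conclusion
    fails, every [A] in [F] meets at least [0.51 m] members of [F], so
    [0.51 m <= \sum_(y in A) d y]. Summing this over the members [A] through a
    fixed [x] gives [0.51 m d x <= (d x)^2 + m^2 / (4k)], and for [k >= 50] this
    forces [d x >= m / 2] or [d x <= m / (2k)]. If [d x >= m / 2] for some [x], a
    member of [F] avoiding [x] meets at most [m / 2 + m / (4k)] members; otherwise
    [\sum_(y in A) d y <= m / 2] for every [A]. Both contradict [0.51 m]. *)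
Require Import Defs.
From mathcomp Require Import all_boot all_order all_algebra.
From mathcomp Require Import zify lra.
Import Order.TTheory GRing.Theory Num.Theory.
Local Open Scope ring_scope.

Section FamilyDegrees.
Set Implicit Arguments.
Unset Strict Implicit.
Local Open Scope nat_scope.
Context {T : finType}.
Implicit Types (F : {set {set T}}) (A S : {set T}) (x y : T).

Definition degree F x := #|[set A in F | x \in A]|.

Definition codegree F x y := #|[set A in F | (x \in A) && (y \in A)]|.

(** Deleting [S] is injective on supersets of [S] and yields subsets of its complement of size
    [k - #|S|]. *)
Lemma card_supersets_le S k :
  #|[set A : {set T} | (S \subset A) && (#|A| == k)]| <=
    'C(#|T| - #|S|, k - #|S|).
Proof.
have -> : #|T| - #|S| = #|~: S| by rewrite [RHS]cardsCs setCK.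
rewrite -cards_draws.
rewrite -(@card_in_imset _ _ (fun A => A :\: S)); last first.
  move=> A B; rewrite !inE => /andP[/setIidPr SA _] /andP[/setIidPr SB _] E.
  by rewrite -(setID A S) -(setID B S) E SA SB.
apply/subset_leq_card/subsetP => _ /imsetP[A + ->].
rewrite !inE => /andP[SA /eqP Ak].
by rewrite setDE subsetIr -setDE cardsDS // Ak eqxx.
Qed.

Lemma degree_le F k x : {in F, forall A, #|A| = k} ->
  degree F x <= 'C(#|T|.-1, k.-1).
Proof.
move=> unifF; have := card_supersets_le [set x] k.
rewrite cards1 !subn1; apply/leq_trans/subset_leq_card/subsetP => A.
by rewrite !inE sub1set => /andP[/unifF -> ->] /=.
Qed.

Lemma codegree_le F k x y : {in F, forall A, #|A| = k} -> x != y ->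
  codegree F x y <= 'C(#|T| - 2, k - 2).
Proof.
move=> unifF xy; have := card_supersets_le [set x; y] k.
rewrite cards2 xy; apply/leq_trans/subset_leq_card/subsetP => A.
by rewrite !inE subUset !sub1set => /andP[/unifF -> ->] /=.
Qed.

Lemma codegreexx F x : codegree F x x = degree F x.
Proof. by apply: eq_card => A; rewrite !inE andbb. Qed.

Lemma degreeE F x : degree F x = \sum_(A in F) (x \in A).
Proof.
rewrite /degree -sum1_card big_mkcond [RHS]big_mkcond /=.
by apply: eq_bigr => A _; rewrite inE; case: (A \in F); case: (x \in A).
Qed.

Lemma codegreeE F x y :
  codegree F x y = \sum_(A in F | x \in A) (y \in A).
Proof.
rewrite /codegree -sum1_card big_mkcond [RHS]big_mkcond /=.
apply: eq_bigr => A _; rewrite inE.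
by case: (A \in F); case: (x \in A); case: (y \in A).
Qed.

Lemma sum_degree F k : {in F, forall A, #|A| = k} ->
  \sum_x degree F x = k * #|F|.
Proof.
move=> unifF; under eq_bigr do rewrite degreeE.
rewrite exchange_big /= mulnC -sum_nat_const; apply: eq_bigr => A /unifF <-.
by rewrite -sum1_card [RHS]big_mkcond; apply: eq_bigr => x _; case: (x \in A).
Qed.

Lemma sum_degree_codegree F x :
  \sum_(A in F | x \in A) \sum_(y in A) degree F y =
    \sum_y degree F y * codegree F x y.
Proof.
under eq_bigr do rewrite big_mkcond.
rewrite exchange_big; apply: eq_bigr => y _ /=.
rewrite codegreeE big_distrr; apply: eq_bigr => A _ /=.
by case: (y \in A); rewrite ?muln1 ?muln0.
Qed.

Lemma card_meeting_le F A :
  #|[set B in F | ~~ [disjoint B & A]]| <= \sum_(y in A) degree F y.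
Proof.
under eq_bigr do rewrite degreeE.
rewrite exchange_big -sum1_card big_mkcond [leqRHS]big_mkcond /=.
apply: leq_sum => B _; rewrite inE; case: (B \in F) => //=.
case: ifP => // /pred0Pn[y /andP[/= yB yA]].
by rewrite (bigD1 y) //= yB.
Qed.

(** Compare the contributions of each [B] in [F]: the left side reaches 2 only if [B] contains [x]
    and meets [A], and then some [y] in [A] adds 1 on the right. For [x] outside [A] only true
    codegrees occur in the sum. *)
Lemma card_meeting_codegree_le F A x :
  #|[set B in F | ~~ [disjoint B & A]]| + degree F x <=
    #|F| + \sum_(y in A) codegree F x y.
Proof.
under eq_bigr do rewrite codegreeE.
rewrite exchange_big -!sum1_card /degree -sum1_card.
rewrite big_mkcond [X in _ + X]big_mkcond [X in _ <= X + _]big_mkcond.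
rewrite [X in _ <= _ + X]big_mkcond /= -!big_split /=.
apply: leq_sum => B _; rewrite !inE; case: (B \in F) => //=.
case: (boolP (x \in B)) => xB; last by case: ifP.
case: ifP => // /pred0Pn[y /andP[/= yB yA]].
by rewrite (bigD1 y) //= yB leq_add2l.
Qed.

Lemma card_disjoint_meeting F A :
  #|[set B in F | [disjoint B & A]]| + #|[set B in F | ~~ [disjoint B & A]]|
    = #|F|.
Proof.
rewrite -(cardsID [set B : {set T} | [disjoint B & A]] F).
by congr (_ + _); apply: eq_card => B; rewrite !inE // andbC.
Qed.

End FamilyDegrees.

(** The ratio of the two binomials is [(n - 1) / (k - 1)], and [4 * k ^ 2 * (k - 1) <= n - 1]. *)
Lemma bin_codegree_le (n k : nat) : (1 < k)%N -> (4 * k ^ 3 <= n)%N ->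
  (4 * k ^ 2 * 'C(n - 2, k - 2) <= 'C(n.-1, k.-1))%N.
Proof.
case: k => [|[|k]] // _; case: n => [|[|n]] hn; [lia|lia|].
rewrite !subn2 /= -(leq_pmul2l (ltn0Sn k)) -mul_bin_diag /= mulnA leq_mul2r.
by apply/orP; right; rewrite !expnS expn0 in hn *; nia.
Qed.

Lemma degree_dichotomy (m k d : nat) : (50 <= k)%N -> (d <= m)%N ->
  (204 * k * m * d <= 400 * k * d ^ 2 + 100 * m ^ 2)%N ->
  (m <= 2 * d)%N \/ (2 * k * d <= m)%N.
Proof.
move=> hk hd h; case: (leqP m (2 * d)) => hmd; [by left | right].
(* At [k = 50] the two sides of [h] differ by exactly [100 * (m - 2 * d) * (100 * d - m)]; as
   [2 * d < m], a larger [k] only strengthens [h]. *)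
have small : (100 * d <= m)%N.
  rewrite leqNgt; apply/negP => hdm.
  have neg : (0 < (m - 2 * d) * (100 * d - m))%N by rewrite muln_gt0; lia.
  have mono : (50 * (4 * d * (51 * m - 100 * d)) <=
               k * (4 * d * (51 * m - 100 * d)))%N by rewrite leq_mul2r hk orbT.
  nia.
(* Bootstrapping: by [small], the quadratic term is at most [4 * k * m * d], which leaves 200 of the
   204. *)
have : (200 * k * m * d <= 100 * m ^ 2)%N.
  have : (100 * d * (4 * k * d) <= m * (4 * k * d))%N by rewrite
      leq_mul2r small orbT.
  nia.
have m0 : (0 < m)%N by lia.
by rewrite -(leq_pmul2l m0); nia.
Qed.

Theorem theorem7 (n k : nat) (F : {set {set 'I_n}})
  (hk : (50 <= k)%N) (hn : (4 * k ^ 3 <= n)%N)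
  (hF : F \subset ksubsets n k)
  (hcard : ('C(n.-1, k.-1) < #|F|)%N) :
  49%:R / 100%:R * #|F|%:R < (max_disjoint F)%:R :> rat.
Proof.
suff : (49 * #|F| < 100 * max_disjoint F)%N.
  by rewrite -(ltr_nat rat) !natrM; lra.
rewrite ltnNge; apply/negP => hmax.
have unifF : {in F, forall A : {set 'I_n}, #|A| = k}.
  by move=> A /(subsetP hF); rewrite inE => /eqP.
set m := #|F| in hcard hmax *; set b := 'C(n - 2, k - 2).
have hb : (4 * k ^ 2 * b <= m)%N.
  by apply: leq_trans (ltnW hcard); apply: bin_codegree_le; lia.
have cod x y : x != y -> (codegree F x y <= b)%N.
  by move=> /(codegree_le unifF); rewrite card_ord.
have meet A : A \in F -> (51 * m <= 100 * #|[set B in F | ~~ [disjoint B & A]]|)%N.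
  move=> AF; have := card_disjoint_meeting F A.
  have := @leq_bigmax_cond _ (mem F)
    (fun A : {set 'I_n} => #|[set B in F | [disjoint B & A]]|) A AF.
  by rewrite -/(max_disjoint F) -/m; lia.
have degm x : (degree F x <= m)%N.
  by apply: subset_leq_card; apply/subsetP => A; rewrite inE => /andP[].
have quad x : (51 * m * degree F x <= 100 * (degree F x ^ 2 + b * (k * m)))%N.
  have : (\sum_(A in F | x \in A) 51 * m <=
      \sum_(A in F | x \in A) 100 * \sum_(y in A) degree F y)%N.
    apply: leq_sum => A /andP[AF _]; apply: leq_trans (meet _ AF) _.
    by rewrite leq_mul2l card_meeting_le.
  rewrite -[leqRHS]big_distrr /= sum_degree_codegree.
  have -> : (\sum_(A in F | x \in A) 51 * m = 51 * m * degree F x)%N.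
    by rewrite sum_nat_cond_const mulnC.
  move=> /leq_trans; apply; rewrite leq_mul2l /=.
  (* The term [y = x] gives the square; the others have codegree at most [b], and all degrees sum to
     [k * m]. *)
  rewrite (bigD1 x) //= codegreexx expnS expn1 leq_add2l.
  rewrite -(sum_degree unifF) big_distrr [leqRHS](bigD1 x) //=.
  apply: leq_trans (leq_addl _ _); apply: leq_sum => y yx.
  by rewrite mulnC leq_mul2r cod 1?eq_sym ?orbT.
have dich x : (m <= 2 * degree F x)%N \/ (2 * k * degree F x <= m)%N.
  apply: degree_dichotomy => //; have := quad x.
  have : (4 * k ^ 2 * b * m <= m * m)%N by rewrite leq_mul2r hb orbT.
  move: (degree F x) => d hbm hq.
  have : (4 * k * (51 * m * d) <= 4 * k * (100 * (d ^ 2 + b * (k * m))))%N.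
    by rewrite leq_mul2l hq orbT.
  nia.
have [x hx|nox] := pickP [pred x | (m <= 2 * degree F x)%N].
  (* [F] is larger than a full star, so some member avoids [x]. *)
  have : ~~ (F \subset [set A in F | x \in A]).
    apply/negP => /subset_leq_card; rewrite leqNgt => /negP; apply.
    by apply: leq_ltn_trans hcard; have := degree_le x unifF; rewrite card_ord.
  case/subsetPn => A AF; rewrite inE AF /= => xA.
  have := card_meeting_codegree_le F A x; have := meet A AF.
  have : (\sum_(y in A) codegree F x y <= k * b)%N.
    rewrite -(unifF A AF) -sum_nat_const; apply: leq_sum => y yA.
    by apply: cod; apply: contraNneq xA => ->.
  (* Since [4 * k >= 200]. The contradiction is then [0.51 m + 0.5 m <= m + 0.005 m] with [m]
     positive. *)
  have : (200 * (k * b) <= m)%N.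
    by apply: leq_trans hb; rewrite expnS expn1 !mulnA !leq_mul2r; lia.
  by move: hx; rewrite inE -/m; lia.
have /card_gt0P[A AF] : (0 < #|F|)%N by apply: leq_ltn_trans hcard.
(* All degrees are now on the low side of [dich], so the [k] points of [A] have total degree at most
   [m / 2]. *)
have : (\sum_(y in A) 2 * k * degree F y <= k * m)%N.
  rewrite -(unifF A AF) -sum_nat_const; apply: leq_sum => y _.
  by rewrite (unifF A AF); case: (dich y) => //; have := nox y; rewrite inE => ->.
rewrite -big_distrr /=; have := meet A AF; have := card_meeting_le F A.
move: (\sum_(y in A) _)%N => s h1 h2; rewrite -mulnA mulnCA leq_pmul2l; last lia.
lia.
Qed.
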